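(* Let $\theta$ be a primitive substitution, let $N\ge 1$, let $\hat\theta_N$ be the $N$-block substitution of $\theta$, and let $(X^{[N]}_\theta,\sigma)$ be the $N$-block presentation of the system $(X_\theta,\sigma)$. Then $X^{[N]}_\theta=X_{\hat\theta_N}$.
   Context: A substitution $\theta$ on a finite alphabet $A$ is a map from $A$ to non-empty finite words over $A$, extended to words and sequences by concatenation. It is primitive if for some $k\ge1$ every letter occurs in $\theta^k(a)$ for all $a\in A$. The language $\mathcal L_\theta$ is the set of finite words occurring in some $\theta^k(a)$, $k\ge1$, $a\in A$; $\mathcal L_\theta^N$ is the set of words of length $N$ in $\mathcal L_\theta$; $X_\theta\subset A^{\mathbb Z}$ is the set of two-sided sequences all of whose finite subwords lie in $\mathcal L_\theta$; $\sigma$ is the left shift. $N$-block presentation: take the alphabet of symbols $[a_1a_2\dots a_N]$ with $a_1\dots a_N\in\mathcal L^N_\theta$, and let $\Psi(a_1\dots a_N)=[a_1\dots a_N]$. Then $X^{[N]}_\theta$ is the image of $X_\theta$ under the sliding block code $\psi$ induced by $\Psi$, i.e. (up to a fixed shift of the indexing) $\psi(x)_k=[x_kx_{k+1}\dots x_{k+N-1}]$. $N$-block substitution: $\hat\theta_N$ is the substitution on this same alphabet such that $\hat\theta_N([a_1\dots a_N])$ has length $L_1=|\theta(a_1)|$ and its letters are, in order, the $\Psi$-codings of the first $L_1$ consecutive subwords of length $N$ of the word $\theta(a_1a_2\dots a_N)$ (those starting at positions $1,\dots,L_1$). $X_{\hat\theta_N}$ is defined from $\hat\theta_N$ as $X_\theta$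 is from $\theta$. *)

(* Defs.v *)
From mathcomp Require Import all_boot all_order all_algebra.
From mathcomp Require Import boolp classical_sets.

Set Implicit Arguments.
Unset Strict Implicit.
Unset Printing Implicit Defensive.

Local Open Scope classical_set_scope.

Record substitution (A : finType) := Substitution {
  subst_letter :> A -> seq A;
  subst_nonempty : forall a, subst_letter a != [::]
}.

Definition subst_word (A : finType) (theta : substitution A) (w : seq A) :
  seq A := flatten [seq theta a | a <- w].

Definition subst_iter (A : finType) (theta : substitution A) (k : nat) (a : A) :
  seq A := iter k (subst_word theta) [:: a].

Definition primitive (A : finType) (theta : substitution A) : Prop :=
  exists2 k, 0 < k & forall a b : A, b \in subst_iter theta k a.

Definition language (A : finType) (theta : substitution A) : set (seq A) :=
  [set u | exists2 k, 0 < k & exists a, infix u (subst_iter theta k a)].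

(* The word x_i x_{i+1} ... x_{i+n-1}. *)
Definition subword (A : Type) (x : int -> A) (i : int) (n : nat) : seq A :=
  mkseq (fun j => x (i + j%:Z)%R) n.

Definition subst_shift (A : finType) (theta : substitution A) :
  set (int -> A) := [set x | forall i n, language theta (subword x i n)].

(* The alphabet of symbols [a_1 ... a_N]; the coding Psi is the constructor of
   this subtype. *)
Definition block (A : finType) (theta : substitution A) (N : nat) : finType :=
  {w : N.-tuple A | tval w \in language theta}.

Lemma size_subword (A : Type) (x : int -> A) i n :
  size (subword x i n) == n.
Proof. by rewrite size_mkseq. Qed.

Section BlockCode.
Variables (A : finType) (theta : substitution A) (N : nat).

Lemma block_code_subproof (x : {x | subst_shift theta x}) (k : int) :
  tval (Tuple (size_subword (sval x) k N)) \in language theta.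
Proof. by rewrite inE; exact: (svalP x). Qed.

Definition block_code (x : {x | subst_shift theta x}) : int -> block theta N :=
  fun k => exist _ (Tuple (size_subword (sval x) k N))
             (block_code_subproof x k).

Definition block_presentation : set (int -> block theta N) := range block_code.

End BlockCode.

Arguments block_presentation {A} theta N.

Section BlockSubstitution.
Variables (A : finType) (theta : substitution A) (N : nat) (N_gt0 : 0 < N).

Definition block_head (w : block theta N) : A :=
  tnth (sval w) (Ordinal N_gt0).

(* The length-N subword of theta(w) at position i, counted from 0. *)
Definition image_subword (w : block theta N) (i : nat) : seq A :=
  take N (drop i (subst_word theta (sval w))).

Lemma size_subst_word (s : seq A) : size s <= size (subst_word theta s).
Proof.
elim: s => [//|a s IHs]; rewrite /subst_word /= size_cat -add1n.
by apply: leq_add IHs; rewrite lt0n size_eq0 subst_nonempty.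
Qed.

Lemma subst_word_infix (u v : seq A) :
  infix u v -> infix (subst_word theta u) (subst_word theta v).
Proof.
case/infixP=> [p [s ->]]; apply/infixP.
exists (subst_word theta p), (subst_word theta s).
by rewrite /subst_word !map_cat !flatten_cat.
Qed.

Lemma language_subst_word (u : seq A) :
  language theta u -> language theta (subst_word theta u).
Proof.
case=> k k_gt0 [a ua]; exists k.+1 => //; exists a.
by rewrite /subst_iter iterS subst_word_infix.
Qed.

Lemma language_infix (u v : seq A) :
  infix u v -> language theta v -> language theta u.
Proof.
by move=> uv [k k_gt0 [a va]]; exists k => //; exists a; apply: infix_trans va.
Qed.

Lemma block_cons (w : block theta N) :
  tval (sval w) = block_head w :: behead (sval w).
Proof.
rewrite /block_head; set a := tnth _ _.
have -> : a = nth a (sval w) 0 by rewrite {1}/a (tnth_nth a).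
have : 0 < size (sval w) by rewrite size_tuple.
by case: (tval (sval w)).
Qed.

Lemma size_image_subword (w : block theta N)
    (i : 'I_(size (theta (block_head w)))) :
  size (image_subword w i) == N.
Proof.
rewrite size_takel // size_drop.
have szb : N.-1 <= size (subst_word theta (behead (sval w))).
  by rewrite -{1}(size_tuple (sval w)) -size_behead size_subst_word.
rewrite block_cons /subst_word /= size_cat -/(subst_word _ _).
rewrite leq_subRL; last by rewrite (leq_trans (ltnW (ltn_ord i))) ?leq_addr.
by apply: leq_trans (leq_add (ltn_ord i) szb); rewrite addSn -addnS prednK.
Qed.

Lemma image_subword_language (w : block theta N)
    (i : 'I_(size (theta (block_head w)))) :
  tval (Tuple (size_image_subword i)) \in language theta.
Proof.
rewrite inE /=; apply: (@language_infix _ (subst_word theta (sval w))).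
  apply: (@infix_trans _ (drop i (subst_word theta (sval w)))).
    by apply/prefixW/prefix_take.
  by apply/suffixW/suffix_drop.
by apply: language_subst_word; have := svalP w; rewrite inE.
Qed.

Definition block_subst_letter (w : block theta N) : seq (block theta N) :=
  [seq exist _ (Tuple (size_image_subword i)) (image_subword_language i)
     | i <- ord_enum (size (theta (block_head w)))].

Lemma block_subst_nonempty (w : block theta N) : block_subst_letter w != [::].
Proof.
rewrite -size_eq0 size_map -(size_map val) val_ord_enum size_iota.
by rewrite size_eq0 subst_nonempty.
Qed.

Definition block_subst : substitution (block theta N) :=
  Substitution block_subst_nonempty.

End BlockSubstitution.

Arguments block_subst {A} theta {N} N_gt0.

(* Main.v *)
Require Import Defs.
From mathcomp Require Import all_boot all_order all_algebra.
From mathcomp Require Import boolp classical_sets.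

(** Since [theta^k w] starts with [theta^k w_0], an induction on [k] shows that
the word obtained by iterating the block substitution [k] times on [[w]] codes
the first [|theta^k w_0|] windows of length [N] of [theta^k w]. Hence
every word of the block language is the coding of a word of the language of
[theta]. Conversely, if [u] occurs in [theta^k a], then the coding of [u] occurs
in the [k]-th image of any block whose first letter is [a]; such a block exists
by primitivity as soon as the language contains a word of length [N + 1]. *)

Set Implicit Arguments.
Unset Strict Implicit.
Unset Printing Implicit Defensive.

Section Windows.
Variables (A : Type) (N : nat).
Implicit Types u v p q : seq A.

(* The first [n] windows of length [N] of [v]; windows overrunning the end of
   [v] are truncated. *)
Definition windows v n : seq (seq A) := mkseq (fun i => take N (drop i v)) n.

Lemma size_windows v n : size (windows v n) = n.
Proof. exact: size_mkseq. Qed.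

Lemma windowsD v m n :
  windows v (m + n) = windows v m ++ windows (drop m v) n.
Proof.
rewrite /windows /mkseq iotaD map_cat add0n -{2}(addn0 m) iotaDl -map_comp.
by congr (_ ++ _); apply: eq_map => i /=; rewrite drop_drop addnC.
Qed.

(** The last of the [n] windows ends at position [n + N.-1], so none of them reaches into [v]. *)
Lemma windows_catl u v n :
  n + N.-1 <= size u -> 0 < N -> windows (u ++ v) n = windows u n.
Proof.
move=> szu N_gt0; apply/eq_in_map => i; rewrite mem_iota /= add0n => lt_in.
have le_iN : i + N <= size u.
  by apply: leq_trans szu; rewrite -(prednK N_gt0) addnS -addSn leq_add2r.
have le_iu : i <= size u by apply: leq_trans le_iN; apply: leq_addr.
rewrite drop_cat; case: ltnP => [_|le_ui].
  by rewrite takel_cat // size_drop leq_subRL.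
have Ei : i = size u by apply/eqP; rewrite eqn_leq le_iu.
by move: le_iN; rewrite Ei -{2}(addn0 (size u)) leq_add2l leqNgt N_gt0.
Qed.

End Windows.

Lemma map_subword (A B : Type) (f : A -> B) x i n :
  map f (subword x i n) = subword (f \o x) i n.
Proof. by rewrite /subword /mkseq -map_comp. Qed.

Lemma windows_subword (A : Type) N (x : int -> A) i n :
  windows N (subword x i (n + N.-1)) n = subword (fun k => subword x k N) i n.
Proof.
case: N => [|N] /=; first by apply: eq_map => j; rewrite take0.
apply/eq_in_map => j; rewrite mem_iota /= add0n => lt_jn.
rewrite /subword /mkseq -map_drop -map_take drop_iota take_iota add0n.
have -> : minn N.+1 (n + N - j) = N.+1.
  by apply/minn_idPl; rewrite leq_subRL ?addnS -?addSn ?leq_add2r // ltnW ?ltn_addr.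
rewrite -{1}(addn0 j) iotaDl -map_comp; apply: eq_map => k /=.
by rewrite PoszD GRing.addrA.
Qed.

Lemma infix_map_inj (T1 T2 : eqType) (f : T1 -> T2) (s t : seq T1) :
  injective f -> infix (map f s) (map f t) -> infix s t.
Proof.
move=> f_inj /infixP[p [q Et]]; apply/infixP.
(* [p] and [q] are words over [T2]; the matching pieces of [t] are cut out by length. *)
exists (take (size p) t), (drop (size p + size s) t).
apply: (inj_map f_inj).
rewrite !map_cat map_take map_drop Et take_size_cat // catA.
by rewrite drop_size_cat ?size_cat ?size_map // -catA.
Qed.

Section SubstitutionWords.
Variables (A : finType) (theta : substitution A).

Lemma subst_word_cat u v :
  subst_word theta (u ++ v) = subst_word theta u ++ subst_word theta v.
Proof. by rewrite /subst_word map_cat flatten_cat. Qed.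

Lemma iter_subst_word_cat k u v :
  iter k (subst_word theta) (u ++ v) =
  iter k (subst_word theta) u ++ iter k (subst_word theta) v.
Proof. by elim: k => //= k ->; rewrite subst_word_cat. Qed.

Lemma size_iter_subst_word k u : size u <= size (iter k (subst_word theta) u).
Proof.
by elim: k => //= k IHk; apply: leq_trans IHk (size_subst_word theta _).
Qed.

Lemma language_iter_subst_word k u :
  language theta u -> language theta (iter k (subst_word theta) u).
Proof. by move=> Lu; elim: k => //= k; apply: language_subst_word. Qed.

(** With [b] the first letter of [v], primitivity puts [a] into [theta^k b]; the other letters of
    [v], at least [N] of them, have an image long enough to fill the [N] places after [a]. *)
Lemma primitive_language_starting N v a :
  primitive theta -> language theta v -> N < size v ->
  exists2 w, language theta (a :: w) & size (a :: w) = N.+1.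
Proof.
case=> k _ prim_k Lv; case: v Lv => [//|b v] Lv; rewrite /= ltnS => szv.
have /splitPr Eb := prim_k b a; case E: _ / Eb => [p q].
have := language_iter_subst_word k Lv.
rewrite -cat1s iter_subst_word_cat.
rewrite -/(subst_iter theta k b) E -catA cat_cons => Lpaq.
exists (take N (q ++ iter k (subst_word theta) v)).
  apply: language_infix Lpaq.
  apply: (@infix_trans _ (a :: q ++ iter k (subst_word theta) v)).
    apply/prefixW; exact: (prefix_take (a :: _) N.+1).
  exact: infix_catl (infix_refl _).
rewrite /= size_takel // size_cat.
exact: leq_trans (leq_trans szv (size_iter_subst_word k v)) (leq_addl _ _).
Qed.

End SubstitutionWords.

Section BlockWords.
Variables (A : finType) (theta : substitution A) (N : nat) (N_gt0 : 0 < N).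

Local Notation hat := (block_subst theta N_gt0).

Definition block_word (b : block theta N) : seq A := tval (sval b).

(** Lets equalities and occurrences over the block alphabet be checked after decoding to words over
    [A]. *)
Lemma block_word_inj : injective block_word.
Proof. by move=> b c /val_inj /val_inj. Qed.

Lemma size_block_word b : size (block_word b) = N.
Proof. exact: size_tuple. Qed.

Lemma language_block_word b : language theta (block_word b).
Proof. by have := svalP b; rewrite inE. Qed.

Lemma block_of_word (w : seq A) :
  language theta w -> size w = N -> exists b, block_word b = w.
Proof.
move=> Lw /eqP szw.
have Lw' : tval (Tuple szw) \in language theta by rewrite inE.
by exists (exist _ (Tuple szw) Lw').
Qed.

Lemma block_head_take b a s :
  block_word b = take N (a :: s) -> block_head N_gt0 b = a.
Proof.
move=> Eb; have := block_cons N_gt0 b.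
by rewrite -/(block_word b) Eb -[X in take X _](prednK N_gt0) => -[].
Qed.

Lemma map_block_subst_letter b :
  map block_word (hat b) =
  windows N (subst_word theta (block_word b)) (size (theta (block_head N_gt0 b))).
Proof.
rewrite /= /block_subst_letter -map_comp /windows /mkseq -val_ord_enum.
by rewrite -map_comp; apply: eq_map => i.
Qed.

(** The suffix [r] is the lookahead for windows that start in [p] but end beyond it; keeping it
    fixed allows an induction on [p], one block per letter. *)
Lemma map_block_subst_word p r B :
  map block_word B = windows N (p ++ r) (size p) ->
  map block_word (subst_word hat B) =
  windows N (subst_word theta (p ++ r)) (size (subst_word theta p)).
Proof.
elim: p B => [|a p IHp] [|b B] //=.
rewrite -[in windows _ _ _]add1n windowsD /= drop0 => -[Eb EB].
rewrite [in RHS]/subst_word /= size_cat windowsD drop_size_cat //.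
rewrite -!/(subst_word _ _) -(IHp B) //.
rewrite {1}/subst_word /= !map_cat; congr (_ ++ _).
have Ea := block_head_take Eb.
rewrite -[block_subst_letter _ _]/(hat b) map_block_subst_letter Ea.
(* Since [b] is the first window of [a :: p ++ r], its image is a prefix of the whole image. *)
have -> : theta a ++ subst_word theta (p ++ r) =
    subst_word theta (block_word b) ++ subst_word theta (drop N (a :: p ++ r)).
  by rewrite -subst_word_cat Eb cat_take_drop.
rewrite windows_catl //.
(* The [N.-1] letters of [b] after [a] have non-empty images, so the windows starting in [theta a]
   end inside the image of [b]. *)
rewrite /block_word (block_cons N_gt0) Ea /subst_word /= size_cat leq_add2l.
by rewrite -[X in X.-1](size_block_word b) -size_behead size_subst_word.
Qed.

Lemma map_iter_block_subst k b :
  map block_word (subst_iter hat k b) =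
  windows N (iter k (subst_word theta) (block_word b))
    (size (subst_iter theta k (block_head N_gt0 b))).
Proof.
have Eb : block_word b = [:: block_head N_gt0 b] ++ behead (block_word b).
  exact: block_cons.
elim: k => [|k IHk] /=.
  by rewrite /windows /mkseq /= drop0 take_oversize // size_block_word.
(* Here [p] is the [k]-th image of the first letter and [r] that of the remaining letters. *)
rewrite Eb iter_subst_word_cat; apply: map_block_subst_word.
by rewrite IHk {1}Eb iter_subst_word_cat.
Qed.

Lemma block_language_windows B :
  language hat B ->
  exists2 q, language theta q & map block_word B = windows N q (size B).
Proof.
case=> k _ [b /infixP[P [S EB]]].
have Lb := language_iter_subst_word k (language_block_word b).
(* The symbols of [P] code the first [size P] windows, so those of [B] code the windows from
   position [size P] on. *)
exists (drop (size P) (iter k (subst_word theta) (block_word b))).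
  by apply: language_infix Lb; apply/suffixW/suffix_drop.
have := congr1 (map block_word) EB; rewrite map_iter_block_subst.
have -> : size (subst_iter theta k (block_head N_gt0 b)) =
    size P + (size B + size S).
  have /(congr1 size) := map_iter_block_subst k b.
  by rewrite size_map size_windows EB !size_cat.
rewrite !windowsD !map_cat => /eqP.
rewrite eqseq_cat ?size_windows ?size_map // => /andP[_].
by rewrite eqseq_cat ?size_windows ?size_map // => /andP[/eqP-> _].
Qed.

Lemma block_language_of_windows B u :
  primitive theta -> language theta u -> size u = size B + N.-1 ->
  (exists2 v, language theta v & size v = N.+1) ->
  map block_word B = windows N u (size B) -> language hat B.
Proof.
move=> prim_theta [k k_gt0 [a /infixP[p [s Ek]]]] szu [v Lv szv] EB.
have [w Lw szw] :
    exists2 w, language theta (a :: w) & size (a :: w) = N.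
  rewrite -(prednK N_gt0); apply: primitive_language_starting Lv _ => //.
  by rewrite szv (leq_ltn_trans (leq_pred N)).
have [b Eb] := block_of_word Lw szw.
have Ea : block_head N_gt0 b = a.
  by have := block_cons N_gt0 b; rewrite -/(block_word b) Eb => -[].
exists k => //; exists b; apply: (infix_map_inj block_word_inj).
rewrite map_iter_block_subst Ea Eb -cat1s iter_subst_word_cat.
(* After the first [size p] windows come those of [u]; [size B] of them fit inside [u], which has
   [size B + N.-1] letters. *)
rewrite -/(subst_iter theta k a) Ek -!catA !size_cat szu -!addnA.
rewrite windowsD drop_size_cat // windowsD (windows_catl (u := u)) ?szu // -EB.
exact: infix_infix.
Qed.

Lemma map_subword_block_code x i n :
  map block_word (subword (block_code N x) i n) =
  windows N (subword (sval x) i (n + N.-1)) n.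
Proof. by rewrite map_subword windows_subword. Qed.

Lemma block_presentation_sub :
  primitive theta ->
  (block_presentation theta N `<=` subst_shift hat)%classic.
Proof.
move=> prim_theta _ [x _ <-] i n.
have Lx := svalP x.
apply: (@block_language_of_windows _ (subword (sval x) i (n + N.-1))) => //.
- by rewrite !size_mkseq.
(* The point [x] itself supplies words of every length. *)
- by exists (subword (sval x) i N.+1); rewrite ?size_mkseq.
- by rewrite map_subword_block_code size_mkseq.
Qed.

(* Reading the first letters of the symbols of [y] recovers [x]; the symbols
   of [y] overlap consistently because [N] consecutive ones code one word. *)
Lemma block_shift_sub :
  (subst_shift hat `<=` block_presentation theta N)%classic.
Proof.
move=> y Ly; pose x k := block_head N_gt0 (y k).
have x_prefix i n : exists2 q, language theta q &
    map block_word (subword y i n) = windows N q n /\ subword x i n = take n q.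
  have [q Lq] := block_language_windows (Ly i n).
  rewrite size_mkseq => Eq; exists q => //; split=> //.
  have Ej j : j < n -> block_word (y (i + j%:Z)%R) = take N (drop j q).
    move=> lt_jn; have := congr1 (fun s => nth [::] s j) Eq.
    by rewrite map_subword !nth_mkseq.
  (* The [j]-th symbol codes the window of [q] at [j]; beyond the end of [q] this window would be
     empty, but a block has [N > 0] letters. *)
  have x_nth a j : j < n -> j < size q /\ x (i + j%:Z)%R = nth a q j.
    move=> lt_jn; have := Ej j lt_jn.
    case: (ltnP j (size q)) => [lt_jq|le_qj].
      by rewrite (drop_nth a lt_jq) => /block_head_take <-.
    move/(congr1 size); rewrite drop_oversize // size_block_word => N0.
    by move: N_gt0; rewrite {1}N0.
  have szq : n <= size q.
    by case: n {Eq Ej} x_nth => // n /(_ (x i) n (ltnSn n))[].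
  apply: (@eq_from_nth _ (x i)); first by rewrite size_mkseq size_takel.
  move=> j; rewrite size_mkseq => lt_jn.
  by rewrite nth_mkseq // nth_take //; case: (x_nth (x i) j lt_jn).
have Lx : subst_shift theta x.
  move=> i n; have [q Lq [_ ->]] := x_prefix i n.
  by apply: language_infix Lq; apply/prefixW/prefix_take.
exists (exist _ x Lx) => //; apply: funext => k; apply: block_word_inj => /=.
(* With [n = N], the first window of [q] is both the word of [y k] and the subword of [x] at [k]. *)
rewrite /block_word /=; have [q _ [Eq ->]] := x_prefix k N.
have := congr1 (nth [::] ^~ 0) Eq.
by rewrite map_subword !nth_mkseq //= GRing.addr0 drop0 => <-.
Qed.

End BlockWords.

Theorem theorem2p1 (A : finType) (theta : substitution A) (N : nat)
    (N_gt0 : (0 < N)%N) :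
  primitive theta ->
  block_presentation theta N = subst_shift (block_subst theta N_gt0).
Proof.
move=> prim_theta; apply/seteqP; split; first exact: block_presentation_sub.
exact: block_shift_sub.
Qed.
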